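(* Geodesic stability is preserved by quasi-isometries: if $X$ and $Y$ are geodesic semimetric spaces that are quasi-isometric and $Y$ satisfies geodesic stability, then $X$ satisfies geodesic stability.
   Context: A semimetric on a set $X$ is a map $d\colon X\times X\to[0,\infty]$ with $d(x,y)=0$ if and only if $x=y$, and $d(x,y)\le d(x,z)+d(z,y)$ for all $x,y,z\in X$ (no symmetry required); $(X,d)$ is then a semimetric space. For $r\ge 0$ put $\mathcal B^+_r(x)=\{y: d(x,y)\le r\}$, $\mathcal B^-_r(x)=\{y: d(y,x)\le r\}$; for $A\subseteq X$, $\mathcal B^{\pm}_r(A)=\bigcup_{a\in A}\mathcal B^{\pm}_r(a)$. The sets $\{y: d(x,y)<r\}$ generate the forward topology of $X$, and the sets $\{y:d(y,x)<r\}$ generate the backward topology. Paths. Equip a real interval $[a,b]$ with the semimetric $d(s,t)=t-s$ if $s\le t$ and $d(s,t)=\infty$ if $s>t$. A directed path in $X$ is a map $P\colon[a,b]\to X$ that is continuous for the forward topologies and also continuous for the backward topologies; $P(a)$ is its starting point, $P(b)$ its end point. Constant (trivial) paths are allowed. Its length is $\ell(P)=\lim_{N\to\infty}\sum_{i=1}^N d(P(t_{i-1}),P(t_i))$ with $t_i=a+i(b-a)/N$. A path is identified with its image when one speaks of points on $P$ or balls around $P$. An $x$-$y$ geodesic is a directed path $P$ from $x$ to $y$ with $d(P(s),P(t))=\ell(P|_{[s,t]})$ for all $s\le t$. For $\gamma\ge1$, $c\ge0$, a $(\gamma,c)$-quasi-geodesic from $x$ to $y$ is a directed path $P$ from $x$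 to $y$ with $\ell(P|_{[s,t]})\le\gamma\, d(P(s),P(t))+c$ for all $s\le t$. $X$ is geodesic if there is an $x$-$y$ geodesic for all $x,y\in X$ with $d(x,y)<\infty$. Geodesic stability. A geodesic semimetric space $X$ satisfies geodesic stability if for all $\gamma\ge1$ and $c\ge0$ there is $\kappa\ge0$ such that for all $x,y\in X$ and all $(\gamma,c)$-quasi-geodesics $P$ and $Q$ from $x$ to $y$, every point of $P$ lies in $\mathcal B^+_\kappa(Q)\cap\mathcal B^-_\kappa(Q)$. Quasi-isometry. A map $f\colon X\to Y$ between semimetric spaces is a quasi-isometry if there are $\gamma\ge1$, $c\ge0$ with $\gamma^{-1}d_X(x,x')-c\le d_Y(f(x),f(x'))\le\gamma d_X(x,x')+c$ for all $x,x'\in X$ (with the usual conventions for $\infty$), and for every $y\in Y$ there is $x\in X$ with $d_Y(f(x),y)\le c$ and $d_Y(y,f(x))\le c$. Then $X$ is called quasi-isometric to $Y$ (this is an equivalence relation). *)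

(* Defs.v *)
From HB Require Import structures.
From mathcomp Require Import all_boot all_order all_algebra.
From mathcomp Require Import all_classical all_reals all_analysis.

Set Implicit Arguments.
Unset Strict Implicit.
Unset Printing Implicit Defensive.

Import Order.TTheory GRing.Theory Num.Theory.

Local Open Scope classical_set_scope.
Local Open Scope ring_scope.

HB.mixin Record isSemimetric (R : realType) (T : Type) := {
  sdist : T -> T -> \bar R;
  sdist_ge0 : forall x y, (0 <= sdist x y)%E;
  sdist_eq0 : forall x y, sdist x y = 0%E <-> x = y;
  sdist_triangle : forall x y z,
    (sdist x y <= sdist x z + sdist z y)%E
}.

#[short(type="semimetricType")]
HB.structure Definition Semimetric (R : realType) := {T of isSemimetric R T}.

(* [forward X] and [backward X] are copies of [X] carrying the forward and the
   backward topology, which differ in general. *)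
Definition forward (R : realType) (X : semimetricType R) : Type := X.
Definition backward (R : realType) (X : semimetricType R) : Type := X.

Section topologies.
Context {R : realType} (X : semimetricType R).

Definition forward_open_balls : set (set X) :=
  [set U | exists (x : X) (r : R), U = [set y | (sdist x y < r%:E)%E]].

Definition backward_open_balls : set (set X) :=
  [set U | exists (x : X) (r : R), U = [set y | (sdist y x < r%:E)%E]].

HB.instance Definition _ := gen_eqMixin (forward X).
HB.instance Definition _ := gen_choiceMixin (forward X).
HB.instance Definition _ :=
  @isSubBaseTopological.Build (forward X) (set X) forward_open_balls id.

HB.instance Definition _ := gen_eqMixin (backward X).
HB.instance Definition _ := gen_choiceMixin (backward X).
HB.instance Definition _ :=
  @isSubBaseTopological.Build (backward X) (set X) backward_open_balls id.

End topologies.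

(* The interval [a, b], in which one can only move to the right. *)
Definition ditv (R : realType) (a b : R) : Type := {t : R | a <= t <= b}.

Section directed_interval.
Context {R : realType} (a b : R).

Definition ditv_dist (s t : ditv a b) : \bar R :=
  if sval s <= sval t then (sval t - sval s)%:E else +oo%E.

Lemma ditv_dist_ge0 s t : (0 <= ditv_dist s t)%E.
Proof.
by rewrite /ditv_dist; case: ifPn => [st|_]; rewrite ?lee_fin ?subr_ge0 ?leey.
Qed.

Lemma ditv_dist_eq0 s t : ditv_dist s t = 0%E <-> s = t.
Proof.
rewrite /ditv_dist; split=> [|->]; last by rewrite lexx subrr.
case: ifPn => // _ [] /eqP; rewrite subr_eq0 => /eqP ts.
exact/val_inj/esym.
Qed.

Lemma ditv_dist_triangle s t u :
  (ditv_dist s t <= ditv_dist s u + ditv_dist u t)%E.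
Proof.
rewrite /ditv_dist; case: (leP (sval s) (sval u)) => [su|_]; last first.
  by case: (sval u <= sval t); rewrite addye ?leey.
case: (leP (sval u) (sval t)) => [ut|_]; last by rewrite addey ?leey.
by rewrite (le_trans su ut) -EFinD lee_fin (addrC (_ - _)) addrA subrK.
Qed.

HB.instance Definition _ := isSemimetric.Build R (ditv a b)
  ditv_dist_ge0 ditv_dist_eq0 ditv_dist_triangle.

End directed_interval.

Section semimetric_spaces.
Context {R : realType} (X : semimetricType R).

Definition fball (r : R) (A : set X) : set X :=
  \bigcup_(x in A) [set y | (sdist x y <= r%:E)%E].

Definition bball (r : R) (A : set X) : set X :=
  \bigcup_(x in A) [set y | (sdist y x <= r%:E)%E].

(* A directed path [a, b] -> X is represented by a total function P : R -> X;
   only its values on [a, b] are ever used. *)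
Definition dpath (a b : R) (P : R -> X) : Prop :=
  [/\ a <= b,
      continuous ((fun t => P (sval t)) : forward (ditv a b) -> forward X) &
      continuous ((fun t => P (sval t)) : backward (ditv a b) -> backward X)].

Definition dpath_from_to (x y : X) (a b : R) (P : R -> X) : Prop :=
  [/\ dpath a b P, P a = x & P b = y].

Definition path_image (a b : R) (P : R -> X) : set X :=
  [set P t | t in [set t | a <= t <= b]].

(* Length of the restriction of P to [s, t]. *)
Definition path_length (P : R -> X) (s t : R) : \bar R :=
  limn (fun N : nat =>
    \sum_(1 <= i < N.+1)
      sdist (P (s + i.-1%:R * (t - s) / N%:R)%R)
            (P (s + i%:R * (t - s) / N%:R)%R))%E.

Definition geodesic (x y : X) (a b : R) (P : R -> X) : Prop :=
  dpath_from_to x y a b P /\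
  forall s t, a <= s -> s <= t -> t <= b ->
    sdist (P s) (P t) = path_length P s t.

Definition quasi_geodesic (g c : R) (x y : X) (a b : R) (P : R -> X) : Prop :=
  dpath_from_to x y a b P /\
  forall s t, a <= s -> s <= t -> t <= b ->
    (path_length P s t <= g%:E * sdist (P s) (P t) + c%:E)%E.

Definition geodesic_space : Prop :=
  forall x y : X, (sdist x y < +oo)%E -> exists a b P, geodesic x y a b P.

Definition geodesic_stability : Prop :=
  forall g c : R, 1 <= g -> 0 <= c ->
  exists2 k : R, 0 <= k &
  forall (x y : X) (a b : R) (P : R -> X) (a' b' : R) (Q : R -> X),
    quasi_geodesic g c x y a b P -> quasi_geodesic g c x y a' b' Q ->
    path_image a b P `<=`
      fball k (path_image a' b' Q) `&` bball k (path_image a' b' Q).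

End semimetric_spaces.

Arguments geodesic_space {R} X.
Arguments geodesic_stability {R} X.

Definition quasi_isometry (R : realType) (X Y : semimetricType R)
    (f : X -> Y) : Prop :=
  exists g c : R, [/\ 1 <= g, 0 <= c,
    forall x x' : X,
      (g^-1%:E * sdist x x' - c%:E <= sdist (f x) (f x'))%E /\
      (sdist (f x) (f x') <= g%:E * sdist x x' + c%:E)%E &
    forall y : Y, exists x : X,
      (sdist (f x) y <= c%:E)%E /\ (sdist y (f x) <= c%:E)%E].

Definition quasi_isometric (R : realType) (X Y : semimetricType R) : Prop :=
  exists f : X -> Y, quasi_isometry f.

(* Main.v *)
From HB Require Import structures.
Require Import Defs.
From mathcomp Require Import all_boot all_order all_algebra.
From mathcomp Require Import all_classical all_reals all_analysis.
From mathcomp Require Import ring lra.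

(* Subdivide a quasi-geodesic P of X into steps of distance at most 2 and, except
   for the last one, at least 1, and join the f-images of the subdivision points
   by geodesics of Y.  The length of a piece of the resulting path Q is
   controlled by the number of its steps, hence by the length of the
   corresponding piece of P, hence by the distance of its end points in X and
   then in Y: Q is a quasi-geodesic.  Moreover every point of P lies a bounded
   distance after one subdivision point and before another one, and likewise for
   every point of Q and the f-images of the subdivision points.  Applying
   stability in Y to the paths obtained from two quasi-geodesics of X and pulling
   back along f, one always composes distances in the same direction, so that
   the lack of symmetry is harmless. *)

Set Implicit Arguments.
Unset Strict Implicit.
Unset Printing Implicit Defensive.

Import Order.TTheory GRing.Theory Num.Theory.

Local Open Scope classical_set_scope.
Local Open Scope ring_scope.

(** * Forward and backward topologies *)

Section topologies.
Context {R : realType} (X : semimetricType R).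
Implicit Types x y z : X.

Lemma sdistxx x : sdist x x = 0%E.
Proof. exact/sdist_eq0. Qed.

Lemma lte_sdist_triangle x y z (r s : R) :
  (sdist x z < r%:E -> sdist z y < s%:E -> sdist x y < (r + s)%:E)%E.
Proof.
move=> xz zy; apply: le_lt_trans (sdist_triangle x y z) _.
by rewrite EFinD; exact: lteD.
Qed.

(** Room left inside an open ball: [e] will be the radius of a smaller ball around the given point.
    The bounds on [u] exclude both infinities. *)
Lemma sdist_gap (u : \bar R) (r : R) : (0 <= u)%E -> (u < r%:E)%E ->
  exists2 e : R, 0 < e & (u < (r - e)%:E)%E.
Proof.
case: u => [u| |] // _; rewrite lte_fin => ur.
by exists ((r - u) / 2); rewrite ?lte_fin; lra.
Qed.

Lemma filter_radii (b : R -> set X) :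
  (forall r s, r <= s -> b r `<=` b s) ->
  Filter (filter_from [set r : R | 0 < r] b).
Proof.
move=> b_mono; apply: filter_from_filter; first by exists 1 => /=.
move=> r s /= r0 s0; exists (Num.min r s); first by rewrite /= lt_min r0.
by move=> y yb; split; apply: b_mono yb; rewrite ge_min lexx ?orbT.
Qed.

(** Filters are closed under finite intersections and supersets, so it suffices to test the members
    of the subbase. The abstract form serves both topologies. *)
Lemma subbase_nbhs_sub (T : topologicalType) (B : set (set T)) (t : T)
    (F : set_system T) : Filter F ->
  (forall U : set T, open U -> exists2 D : set (set T),
    D `<=` finI_from B id & \bigcup_(V in D) V = U) ->
  (forall V, B V -> V t -> F V) ->
  nbhs t `<=` F.
Proof.
move=> FF openB BF U; rewrite nbhsE => -[V [oV Vt] VU].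
have [D DB DV] := openB _ oV.
move: Vt; rewrite -DV => -[W DW Wt].
apply: (@filterS _ F _ W); first by move=> s Ws; apply: VU; rewrite -DV; exists W.
have [E EB EW] := DB _ DW; rewrite -EW in Wt *.
apply: filter_bigI => V' EV'; apply: BF; last exact: Wt.
by have := EB _ EV'; rewrite inE.
Qed.

(** The subbase has balls around arbitrary centres [z]. Going from [z] through [x], the triangle
    inequality puts a ball centred at [x] inside each of them that contains [x]. *)
Lemma nbhs_forwardP x (U : set X) :
  nbhs (x : forward X) (U : set (forward X)) <->
  exists2 r : R, 0 < r & [set y | (sdist x y < r%:E)%E] `<=` U.
Proof.
split=> [|[r r0 xrU]]; last first.
  rewrite nbhsE; exists [set y | (sdist x y < r%:E)%E] => //.
  split; last by rewrite /= sdistxx lte_fin.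
  exists [set [set y | (sdist x y < r%:E)%E]]; last by rewrite bigcup_set1.
  by move=> _ ->; apply: finI_from1; exists x, r.
apply: (@subbase_nbhs_sub (forward X) (@forward_open_balls R X) x
  (filter_from [set r | 0 < r] (fun r => [set y | (sdist x y < r%:E)%E]))) => //.
  apply: filter_radii => r s rs y /= /lt_le_trans; apply.
  by rewrite lee_fin.
move=> _ [z [r ->]] /= /(sdist_gap (sdist_ge0 _ _))[e e0] zx; exists e => //= y xy.
by have := lte_sdist_triangle zx xy; rewrite subrK.
Qed.

Lemma nbhs_backwardP x (U : set X) :
  nbhs (x : backward X) (U : set (backward X)) <->
  exists2 r : R, 0 < r & [set y | (sdist y x < r%:E)%E] `<=` U.
Proof.
split=> [|[r r0 xrU]]; last first.
  rewrite nbhsE; exists [set y | (sdist y x < r%:E)%E] => //.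
  split; last by rewrite /= sdistxx lte_fin.
  exists [set [set y | (sdist y x < r%:E)%E]]; last by rewrite bigcup_set1.
  by move=> _ ->; apply: finI_from1; exists x, r.
apply: (@subbase_nbhs_sub (backward X) (@backward_open_balls R X) x
  (filter_from [set r | 0 < r] (fun r => [set y | (sdist y x < r%:E)%E]))) => //.
  apply: filter_radii => r s rs y /= /lt_le_trans; apply.
  by rewrite lee_fin.
move=> _ [z [r ->]] /= /(sdist_gap (sdist_ge0 _ _))[e e0] xz; exists e => //= y yx.
by have := lte_sdist_triangle yx xz; rewrite addrC subrK.
Qed.

End topologies.

(** * Continuity of directed paths in terms of distances *)

Section eps_delta.
Context {R : realType}.

Lemma forward_continuousP (X Y : semimetricType R) (f : X -> Y) :
  continuous (f : forward X -> forward Y) <->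
  forall (x : X) (e : R), 0 < e -> exists2 d : R, 0 < d &
    forall y, (sdist x y < d%:E -> sdist (f x) (f y) < e%:E)%E.
Proof.
split=> [cf x e e0|cf x U /nbhs_forwardP[e e0 eU]].
  have /(cf x)/nbhs_forwardP[d d0 df] : nbhs (f x : forward Y)
      ([set y | (sdist (f x) y < e%:E)%E] : set (forward Y)).
    by apply/nbhs_forwardP; exists e.
  by exists d => // y /df.
have [d d0 df] := cf x _ e0.
by apply/nbhs_forwardP; exists d => // y /df/eU.
Qed.

Lemma backward_continuousP (X Y : semimetricType R) (f : X -> Y) :
  continuous (f : backward X -> backward Y) <->
  forall (x : X) (e : R), 0 < e -> exists2 d : R, 0 < d &
    forall y, (sdist y x < d%:E -> sdist (f y) (f x) < e%:E)%E.
Proof.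
split=> [cf x e e0|cf x U /nbhs_backwardP[e e0 eU]].
  have /(cf x)/nbhs_backwardP[d d0 df] : nbhs (f x : backward Y)
      ([set y | (sdist y (f x) < e%:E)%E] : set (backward Y)).
    by apply/nbhs_backwardP; exists e.
  by exists d => // y /df.
have [d d0 df] := cf x _ e0.
by apply/nbhs_backwardP; exists d => // y /df/eU.
Qed.

Lemma sdist_ditvE (a b : R) (s t : ditv a b) (d : R) :
  (sdist s t < d%:E)%E <-> sval s <= sval t < sval s + d.
Proof.
rewrite /sdist /= /ditv_dist; case: ifP => // _.
by rewrite lte_fin ltrBlDl.
Qed.

(** In a directed interval forward balls extend only to the right and backward balls only to the
    left. Forward continuity is thus a condition to the right of [t], backward continuity one to the
    left. *)
Lemma dpathP (X : semimetricType R) (a b : R) (P : R -> X) :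
  dpath a b P <-> [/\ a <= b,
    forall t e, a <= t <= b -> 0 < e -> exists2 d, 0 < d &
      forall s, s <= b -> t <= s < t + d -> (sdist (P t) (P s) < e%:E)%E &
    forall t e, a <= t <= b -> 0 < e -> exists2 d, 0 < d &
      forall s, a <= s -> t - d < s <= t -> (sdist (P s) (P t) < e%:E)%E].
Proof.
rewrite /dpath; split=> -[ab]; last first.
  move=> fP bP; split=> //.
    apply/(@forward_continuousP (ditv a b) X) => -[t tab] e e0.
    have [d d0 dP] := fP _ _ tab e0.
    exists d => // -[s sab] /sdist_ditvE/=; apply: dP.
    by case/andP: sab.
  apply/(@backward_continuousP (ditv a b) X) => -[t tab] e e0.
  have [d d0 dP] := bP _ _ tab e0.
  exists d => // -[s sab] /sdist_ditvE/= st; apply: dP; first by case/andP: sab.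
  by rewrite ltrBlDr andbC.
move=> /(@forward_continuousP (ditv a b) X) fP.
move=> /(@backward_continuousP (ditv a b) X) bP; split=> // t e tab e0.
  have [d d0 dP] := fP (exist _ t tab) _ e0.
  exists d => // s sb ts; have sab : a <= s <= b by lra.
  by apply: (dP (exist _ s sab)); apply/sdist_ditvE.
have [d d0 dP] := bP (exist _ t tab) _ e0.
exists d => // s sb st; have sab : a <= s <= b by lra.
by apply: (dP (exist _ s sab)); apply/sdist_ditvE => /=; lra.
Qed.

End eps_delta.

(** * Length of directed paths *)

Section almost_monotone.
Context {R : realType}.
Local Open Scope ereal_scope.

(** Every term is almost exceeded by all late terms, so the limit inferior is already at least the
    supremum. *)
Lemma almost_nondecreasing_cvgn (u : (\bar R)^nat) :
  (forall M (e : R), (0 < e)%R -> \forall N \near \oo, u M <= u N + e%:E) ->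
  u @ \oo --> ereal_sup (range u).
Proof.
move=> uP; set l := ereal_sup _.
have ul n : u n <= l by apply: ereal_sup_ubound; exists n.
have lu : l <= limn_einf u.
  rewrite limn_einf_lim; apply: ge_ereal_sup => _ [M _ <-].
  apply/lee_addgt0Pr => e e0; have [n _ un] := uP M _ e0.
  rewrite -leeBlDr//; apply: (@le_trans _ _ (einfs u n)).
    by apply: le_ereal_inf_tmp => _ [k /un uk <-]; rewrite leeBlDr.
  have /ereal_nondecreasing_cvgn/cvg_lim-> // := nondecreasing_einfs u.
  by apply: ereal_sup_ubound; exists n.
(* The criterion applied asks for a limit superior below a lower bound of all terms, hence the
   passage to [-u]. *)
have : (-%E \o u) @ \oo --> - l.
  by apply: limn_esup_le_cvg => [|n] /=; rewrite ?limn_esupN leeN2.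
by move/cvgeN; rewrite oppeK; under eq_fun do rewrite /= oppeK.
Qed.
End almost_monotone.

Section chains.
Context {R : realType} {X : semimetricType R}.
Implicit Types (P : R -> X) (a b s t : R) (x : nat -> R).

Definition chain P x (m n : nat) : \bar R :=
  (\sum_(m <= k < n) sdist (P (x k)) (P (x k.+1)))%E.

Lemma chain_ge0 P x m n : (0 <= chain P x m n)%E.
Proof. by apply: sume_ge0 => k _; exact: sdist_ge0. Qed.

Lemma chain_cat P x m n p : (m <= n)%N -> (n <= p)%N ->
  chain P x m p = (chain P x m n + chain P x n p)%E.
Proof. exact: big_cat_nat. Qed.

Lemma chainS P x m n : (m <= n)%N ->
  chain P x m n.+1 = (chain P x m n + sdist (P (x n)) (P (x n.+1)))%E.
Proof. by move=> mn; rewrite /chain big_nat_recr. Qed.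

Lemma sdist_chain P x m n : (m <= n)%N ->
  (sdist (P (x m)) (P (x n)) <= chain P x m n)%E.
Proof.
elim: n => [|n IH]; first by rewrite leqn0 => /eqP->; rewrite sdistxx chain_ge0.
rewrite leq_eqVlt => /predU1P[->|mn]; first by rewrite sdistxx chain_ge0.
rewrite chainS//; apply: le_trans (sdist_triangle _ _ (P (x n))) _.
by rewrite leeD2r// IH.
Qed.

Definition grid s t (N k : nat) : R := s + k%:R * (t - s) / N%:R.

Lemma path_lengthE P s t :
  path_length P s t = limn (fun N => chain P (grid s t N) 0 N).
Proof.
rewrite /path_length; congr (limn _); apply/funext => N.
by rewrite big_add1.
Qed.

(** For [s < t], [0 < N] and [s <= z], the index of the last grid point that is at most [z]. *)
Definition cell s t (N : nat) (z : R) : nat :=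
  Num.truncn ((z - s) / ((t - s) / N%:R)).

Lemma cell_itv s t N z : s < t -> (0 < N)%N -> s <= z ->
  grid s t N (cell s t N z) <= z < grid s t N (cell s t N z) + (t - s) / N%:R.
Proof.
move=> st N0 sz; have h0 : 0 < (t - s) / N%:R by rewrite divr_gt0 ?subr_gt0 ?ltr0n.
have /truncn_itv : 0 <= (z - s) / ((t - s) / N%:R).
  by rewrite divr_ge0 ?subr_ge0// ltW.
rewrite -/(cell s t N z) ler_pdivlMr// ltr_pdivrMr// -natr1 /grid -mulrA.
by move: ((t - s) / _) (cell _ _ _ _)%:R => h k; rewrite mulrDl mul1r; lra.
Qed.

Lemma le_cell s t N y z : s < t -> (0 < N)%N -> y <= z ->
  (cell s t N y <= cell s t N z)%N.
Proof.
move=> st N0 yz; apply: le_truncn.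
by rewrite ler_pM2r ?lerB// invr_gt0 divr_gt0 ?subr_gt0 ?ltr0n.
Qed.

Lemma cell_le s t N z : s < t -> (0 < N)%N -> z <= t -> (cell s t N z <= N)%N.
Proof.
move=> st N0 zt; apply: leq_trans (le_cell st N0 zt) _.
by rewrite /cell invf_div mulrA mulrAC divff ?mul1r ?natrK// subr_eq0 gt_eqF.
Qed.

Lemma grid_mono s t N : s <= t -> {homo grid s t N : i j / (i <= j)%N >-> i <= j}.
Proof.
move=> st i j ij; rewrite /grid lerD2l -!mulrA ler_wpM2r// ?ler_nat//.
by rewrite divr_ge0// subr_ge0.
Qed.

Lemma grid0 s t N : grid s t N 0 = s.
Proof. by rewrite /grid !mul0r addr0. Qed.

Lemma gridN s t N : (0 < N)%N -> grid s t N N = t.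
Proof.
move=> N0; rewrite /grid mulrAC divff ?pnatr_eq0 -?lt0n// mul1r.
by rewrite addrC subrK.
Qed.

Lemma gridS s t N k : grid s t N k.+1 = grid s t N k + (t - s) / N%:R.
Proof. by rewrite /grid -natr1 -addrA -!mulrA mulrDl mul1r. Qed.

Lemma near_mesh_lt (l d : R) : 0 < d ->
  \forall N \near \oo, l / N%:R < d.
Proof.
move=> d0; near=> N; have N0 : (0 < N)%N by near: N; exists 1%N.
rewrite ltr_pdivrMr ?ltr0n// mulrC -ltr_pdivrMr//.
near: N; exact: nbhs_infty_gtr.
Unshelve. all: end_near. Qed.

(* Between [y] and [z] the grid loses only the two end pieces, which are short
   by continuity of [P] to the right of [y] and to the left of [z]. *)
Lemma chain_grid_step a b P s t y z (e : R) :
  dpath a b P -> a <= s -> t <= b -> s < t -> s <= y -> y <= z -> z <= t -> 0 < e ->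
  \forall N \near \oo,
    (chain P (grid s t N) 0 (cell s t N y) + sdist (P y) (P z) <=
     chain P (grid s t N) 0 (cell s t N z) + e%:E)%E.
Proof.
move=> /dpathP[ab fP bP] as_ tb st sy yz zt e0.
have yab : a <= y <= b by lra.
have zab : a <= z <= b by lra.
have e20 : 0 < e / 2 by rewrite divr_gt0.
have [d1 d10 d1P] := fP _ _ yab e20.
have [d2 d20 d2P] := bP _ _ zab e20.
near=> N; have N0 : (0 < N)%N by near: N; exists 1%N.
have h1 : (t - s) / N%:R < d1 by near: N; exact: near_mesh_lt.
have h2 : (t - s) / N%:R < d2 by near: N; exact: near_mesh_lt.
have /andP[yl yr] := cell_itv st N0 sy.
have /andP[zl zr] := cell_itv st N0 (le_trans sy yz).
have := le_cell st N0 yz.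
set p := cell s t N y in yl yr *; set q := cell s t N z in zl zr *.
(* If [y] and [z] share a grid cell, the two chains agree, and continuity to the right of [y] alone
   bounds the extra term. *)
rewrite leq_eqVlt => /predU1P[pq|pq].
  rewrite -pq leeD2l// ltW//; apply: lt_le_trans (d1P _ _ _) _; [lra| |].
    by move: zr; rewrite -pq; lra.
  by rewrite lee_fin; lra.
rewrite (chain_cat P (grid s t N) (leq0n p) (ltnW pq)) -addeA leeD2l//.
have pq' : grid s t N p.+1 <= grid s t N q by apply: grid_mono => //; exact: ltW.
have gS := gridS s t N p.
apply: le_trans (sdist_triangle _ _ (P (grid s t N p.+1))) _.
have -> : e%:E = ((e / 2)%:E + (e / 2)%:E)%E by rewrite -EFinD -splitr.
have sg k : s <= grid s t N k.
  by have := @grid_mono s t N (ltW st) _ _ (leq0n k); rewrite grid0.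
have {sg} := sg p.
rewrite addeCA => sp; apply: leeD; first by rewrite ltW//; apply: d1P; lra.
apply: le_trans (sdist_triangle _ _ (P (grid s t N q))) _; apply: leeD; last first.
  by rewrite ltW//; apply: d2P; lra.
apply: le_trans (sdist_chain P (grid s t N) pq) _.
by rewrite (chain_cat P (grid s t N) (leqnSn p) pq) leeDr// chain_ge0.
Unshelve. all: end_near. Qed.

(** Sufficiently fine uniform grids almost dominate any given subdivision, although they need not
    refine it: [chain_grid_step] is applied to each step of [x]. *)
Lemma chain_le_grid a b P s t x n (e : R) :
  dpath a b P -> a <= s -> t <= b -> s <= t ->
  {homo x : i j / (i <= j)%N >-> i <= j} -> s <= x 0%N -> x n <= t -> 0 < e ->
  \forall N \near \oo, (chain P x 0 n <= chain P (grid s t N) 0 N + e%:E)%E.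
Proof.
move=> dP as_ tb st xm sx xt e0.
have [st'|ts] := ltP s t; last first.
  (* In the degenerate interval all points of [x] up to index [n] coincide, so the chain
     vanishes. *)
  have xE k : (k <= n)%N -> x k = s.
    move=> kn; apply/eqP; rewrite eq_le (le_trans sx) ?xm// andbT.
    by rewrite (le_trans (xm _ _ kn))// (le_trans xt).
  apply: nearW => N; rewrite {1}/chain big_nat big1; last first.
    by move=> k /andP[_ kn]; rewrite !xE ?sdistxx// ltnW.
  by rewrite adde_ge0 ?chain_ge0// lee_fin ltW.
(* The induction compares with the grid only up to the cell of [x m]. The error is quantified
   inside, so that half of it can go to the earlier steps and half to the new one. *)
suff H : forall m e, (m <= n)%N -> 0 < e -> \forall N \near \oo,
    (chain P x 0 m <= chain P (grid s t N) 0 (cell s t N (x m)) + e%:E)%E.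
  near=> N; have N0 : (0 < N)%N by near: N; exists 1%N.
  apply: (@le_trans _ _ (chain P (grid s t N) 0 (cell s t N (x n)) + e%:E)%E).
    by near: N; exact: H.
  rewrite leeD2r// (chain_cat P (grid s t N) (leq0n _) (cell_le st' N0 xt)).
  by rewrite leeDl// chain_ge0.
elim=> [|m IH] e' mn e'0.
  by apply: nearW => N; rewrite {1}/chain big_geq// adde_ge0 ?chain_ge0// lee_fin ltW.
near=> N; rewrite chainS//.
apply: (@le_trans _ _ (chain P (grid s t N) 0 (cell s t N (x m)) + (e' / 2)%:E
   + sdist (P (x m)) (P (x m.+1)))%E).
  by rewrite leeD2r//; near: N; apply: IH; [exact: ltnW|rewrite divr_gt0].
have -> : e'%:E = ((e' / 2)%:E + (e' / 2)%:E)%E by rewrite -EFinD -splitr.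
rewrite addeAC addeA leeD2r//.
near: N; apply: (chain_grid_step dP) => //; last by rewrite divr_gt0.
- exact: le_trans sx (xm _ _ _).
- exact: xm.
- exact: le_trans (xm _ _ mn) xt.
Unshelve. all: end_near. Qed.

(* [limn] is a junk value on divergent sequences, and the uniform subdivisions
   defining [path_length] do not refine one another. *)
Lemma cvg_path_length a b P s t : dpath a b P -> a <= s -> s <= t -> t <= b ->
  (fun N => chain P (grid s t N) 0 N) @ \oo --> path_length P s t.
Proof.
move=> dP as_ st tb.
suff /cvgP : (fun N => chain P (grid s t N) 0 N) @ \oo -->
    ereal_sup (range (fun N => chain P (grid s t N) 0 N)).
  by rewrite path_lengthE.
apply: almost_nondecreasing_cvgn => M e e0.
apply: (chain_le_grid dP) => //; first exact: grid_mono.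
  by rewrite grid0.
have [->|M0] := posnP M; first by rewrite grid0.
by rewrite gridN.
Qed.

(** Let the grids in [chain_le_grid] become finer, then let [e] tend to [0]: the limit over uniform
    grids bounds the sums over all subdivisions. *)
Lemma chain_le_path_length a b P s t x n :
  dpath a b P -> a <= s -> s <= t -> t <= b ->
  {homo x : i j / (i <= j)%N >-> i <= j} -> s <= x 0%N -> x n <= t ->
  (chain P x 0 n <= path_length P s t)%E.
Proof.
move=> dP as_ st tb xm sx xt; apply/lee_addgt0Pr => e e0.
have cP := cvg_path_length dP as_ st tb.
rewrite -leeBlDr// -(cvg_lim _ cP)//; apply: lime_ge; first exact: cvgP cP.
near=> N; rewrite leeBlDr//; near: N; exact: (chain_le_grid dP).
Unshelve. all: end_near. Qed.

(** On each grid the bounds by increments of [F] telescope, and the estimate passes to the limit. *)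
Lemma path_length_le a b P s t (F : R -> R) :
  dpath a b P -> a <= s -> s <= t -> t <= b ->
  (forall u v, s <= u -> u <= v -> v <= t ->
    (sdist (P u) (P v) <= (F v - F u)%:E)%E) ->
  (path_length P s t <= (F t - F s)%:E)%E.
Proof.
move=> dP as_ st tb PF; have cP := cvg_path_length dP as_ st tb.
rewrite -(cvg_lim _ cP)//; apply: lime_le; first exact: cvgP cP.
near=> N; have N0 : (0 < N)%N by near: N; exists 1%N.
have gm := @grid_mono s t N st.
suff H n : (n <= N)%N ->
    (chain P (grid s t N) 0 n <= (F (grid s t N n) - F s)%:E)%E.
  by have := H N (leqnn N); rewrite gridN.
elim: n => [|n IH] nN; first by rewrite grid0 subrr /chain big_geq.
rewrite chainS// -(subrKA (F (grid s t N n))) [in leRHS]addrC EFinD.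
rewrite leeD ?IH 1?ltnW//.
apply: PF; rewrite ?gm//.
  by rewrite -{1}(grid0 s t N) gm.
by rewrite -[leRHS](gridN s t N0) gm.
Unshelve. all: end_near. Qed.

End chains.

(** * Subdivisions and broken geodesics *)

(** The left condition puts the supremum of the points satisfying [A] into [A]; the right condition
    would carry [A] beyond it if it were less than [b]. *)
Lemma interval_induction {R : realType} (A : R -> Prop) (a b : R) :
  a <= b -> A a ->
  (forall t, a <= t <= b -> exists2 d, 0 < d &
     forall s, a <= s -> t - d < s <= t -> A s -> A t) ->
  (forall t, a <= t < b -> A t -> exists2 d, 0 < d &
     forall s, s <= b -> t <= s < t + d -> A s) ->
  A b.
Proof.
move=> ab Aa Al Ar.
pose S : set R := [set t | a <= t <= b /\ A t].
have Sa : S a by split; rewrite ?lexx.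
have Sb : ubound S b by move=> t [/andP[]].
have hS : has_sup S by split; [exists a|exists b].
have ac : a <= sup S by apply: ub_le_sup => //; exists b.
have cb : sup S <= b by apply: ge_sup => //; exists a.
have Ac : A (sup S).
  have cab : a <= sup S <= b by rewrite ac.
  have [d d0 dA] := Al _ cab.
  have [s [/andP[as_ sb] As] ds] := sup_adherent d0 hS.
  apply: (dA s) => //; rewrite ds /=; apply: ub_le_sup; first by exists b.
  by split=> //; rewrite as_.
have [cb'|bc] := ltP (sup S) b; last first.
  by have <- : sup S = b by apply/eqP; rewrite eq_le cb.
have cab : a <= sup S < b by rewrite ac.
have [d d0 dA] := Ar _ cab Ac.
pose s := Num.min b (sup S + d / 2).
have cs : sup S < s by rewrite /s lt_min cb'; lra.
have [sb sd] : s <= b /\ s <= sup S + d / 2 by rewrite /s !ge_min !lexx orbT.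
suff : s <= sup S by lra.
apply: ub_le_sup; first by exists b.
split; first by lra.
by apply: dA => //; lra.
Qed.

Section paths.
Context {R : realType} {X : semimetricType R}.
Implicit Types (P Q : R -> X) (a b s t : R) (x : nat -> R).

(** Real induction along the interval: continuity allows moves of distance less than 1, and a point
    is added to the subdivision only when the last step would exceed 2. *)
Lemma coarse_subdivision a b P : dpath a b P ->
  exists (x : nat -> R) (n : nat),
    [/\ {homo x : i j / (i <= j)%N >-> i <= j}, x 0%N = a, x n.+1 = b,
      forall k, (k <= n)%N -> (sdist (P (x k)) (P (x k.+1)) <= 2%:E)%E &
      forall k, (k < n)%N -> (1 <= sdist (P (x k)) (P (x k.+1)))%E].
Proof.
move=> /dpathP[ab fP bP].
(* Here [x] is constant after index [n], so its end point can be moved from [s] to [t] in one go. *)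
pose A t := exists (x : nat -> R) (n : nat),
    [/\ {homo x : i j / (i <= j)%N >-> i <= j}, x 0%N = a,
      forall k, (n < k)%N -> x k = t,
      forall k, (k <= n)%N -> (sdist (P (x k)) (P (x k.+1)) <= 2%:E)%E &
      forall k, (k < n)%N -> (1 <= sdist (P (x k)) (P (x k.+1)))%E].
have step s t : s <= t -> (sdist (P s) (P t) < 1%:E)%E -> A s -> A t.
  move=> st dst [x [n [xm x0 xs x2 x1]]].
  have xle k : x k <= s.
    by rewrite -(xs (maxn k n.+1)) ?leq_max ?ltnSn ?orbT// xm// leq_maxl.
  pose x' m k := if (k < m)%N then x k else t.
  have x'm m : {homo x' m : i j / (i <= j)%N >-> i <= j}.
    move=> i j ij; rewrite /x'; case: ltnP => im; case: ltnP => jm //; first exact: xm.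
      by rewrite (le_trans (xle i)).
    by have := leq_trans im ij; rewrite leqNgt jm.
  have [d2|d2] := leP (sdist (P (x n)) (P t)) 2%:E.
    exists (x' n.+1), n; split=> //.
    - by move=> k nk; rewrite /x' ltnNge nk.
    - move=> k kn; rewrite /x' ltnS kn ltnS; case: ltnP => kn'; first exact: x2.
      by have -> : k = n by apply/eqP; rewrite eqn_leq kn.
    - by move=> k kn; rewrite /x' !ltnS (ltnW kn) kn; exact: x1.
  (* Keep [s] and append [t]. The step into [s] has distance at least 1: otherwise [t] would be
     within 1 + 1 of the point before [s]. *)
  exists (x' n.+2), n.+1; split=> //.
  - by move=> k nk; rewrite /x' ltnNge nk.
  - move=> k kn; rewrite /x' ltnS kn ltnS; case: ltnP => kn'; first exact: x2.
    have -> : k = n.+1 by apply/eqP; rewrite eqn_leq kn.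
    by rewrite (xs n.+1)// ltW// (lt_le_trans dst)// lee_fin; lra.
  - move=> k kn; rewrite /x' ltnS (ltnW kn) ltnS kn.
    move: kn; rewrite ltnS leq_eqVlt => /predU1P[->|]; last exact: x1.
    rewrite leNgt; apply/negP => d1; move: d2; apply/negP; rewrite -leNgt.
    rewrite (xs n.+1)// in d1; have := lte_sdist_triangle d1 dst.
    by rewrite -[1 + 1]/2%R => /ltW.
suff [x [n [xm x0 xb x2 x1]]] : A b by exists x, n; split=> //; exact: xb.
apply: (interval_induction ab).
- exists (fun=> a), 0%N; split=> // k _; rewrite sdistxx lee_fin; lra.
- move=> t tab; have [d d0 dP] := bP _ _ tab (@ltr01 R).
  by exists d => // s as_ std; apply: step; [case/andP: std|exact: dP].
- move=> t /andP[at_ tb] At; have tab : a <= t <= b by rewrite at_ ltW.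
  have [d d0 dP] := fP _ _ tab (@ltr01 R).
  by exists d => // s sb std; apply: step At; [case/andP: std|exact: dP].
Qed.

(** A real-valued substitute for arclength measured along [P]: its increments bound distances, hence
    also lengths by [path_length_le]. *)
Definition arclength_bound a b P (F : R -> R) : Prop :=
  forall s t, a <= s -> s <= t -> t <= b -> (sdist (P s) (P t) <= (F t - F s)%:E)%E.

Lemma arclength_bound_homo a b P F s t : arclength_bound a b P F ->
  a <= s -> s <= t -> t <= b -> F s <= F t.
Proof.
move=> PF as_ st tb; rewrite -subr_ge0 -lee_fin.
exact: le_trans (sdist_ge0 _ _) (PF _ _ as_ st tb).
Qed.

Lemma sdist2_le_path_length a b P s t u : dpath a b P ->
  a <= s -> s <= t -> t <= u -> u <= b ->
  (sdist (P s) (P t) + sdist (P t) (P u) <= path_length P s u)%E.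
Proof.
move=> dP as_ st tu ub.
pose x (k : nat) := if k is k'.+1 then if k' is _.+1 then u else t else s.
have su := le_trans st tu.
have xm : {homo x : i j / (i <= j)%N >-> i <= j} by do 2!case=> [|[|?]].
have := chain_le_path_length (x := x) (n := 2) dP as_ su ub xm (lexx _) (lexx _).
by rewrite /chain big_nat_recr// big_nat1.
Qed.

(** Take the distance from the starting point as [F]. On a geodesic distances are additive, because
    a sum of two consecutive ones is at most the length, which equals the total distance. *)
Lemma geodesic_arclength (x y : X) a b P (D : R) : geodesic x y a b P ->
  (sdist x y <= D%:E)%E ->
  exists F, arclength_bound a b P F /\ F b - F a <= D.
Proof.
move=> [[dP Pa Pb] geoP] xyD; have ab : a <= b by case: dP.
have additive s t u : a <= s -> s <= t -> t <= u -> u <= b ->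
    (sdist (P s) (P t) + sdist (P t) (P u) <= sdist (P s) (P u))%E.
  move=> as_ st tu ub; rewrite (geoP s u)//; last exact: le_trans tu.
  exact: sdist2_le_path_length dP _ _ _ _.
have fin t : a <= t -> t <= b -> sdist (P a) (P t) \is a fin_num.
  move=> at_ tb; rewrite ge0_fin_numE ?sdist_ge0//.
  apply: le_lt_trans (ltry D); apply: le_trans xyD; rewrite -Pa -Pb.
  by apply: le_trans (additive a t b _ _ _ _) => //; rewrite leeDl ?sdist_ge0.
exists (fun t => fine (sdist (P a) (P t))); split.
  move=> s t as_ st tb; have sb := le_trans st tb; have at_ := le_trans as_ st.
  by rewrite EFinB !fineK ?fin// leeBrDl ?fin// additive.
by rewrite sdistxx subr0 -lee_fin fineK ?fin// Pa Pb.
Qed.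

(** * Concatenation of directed paths *)

Definition glue (b a' : R) (T : Type) (P Q : R -> T) (t : R) : T :=
  if t <= b then P t else Q (t - b + a').

Lemma glue_left (b a' : R) (T : Type) (P Q : R -> T) t :
  t <= b -> glue b a' P Q t = P t.
Proof. by rewrite /glue => ->. Qed.

Lemma glue_right (b a' : R) (T : Type) (P Q : R -> T) t :
  P b = Q a' -> b <= t -> glue b a' P Q t = Q (t - b + a').
Proof.
rewrite /glue => PQ bt; case: ifP => // tb.
have -> : t = b by apply/eqP; rewrite eq_le tb.
by rewrite PQ subrr add0r.
Qed.

(** The one-sided conditions settle the junction: at [b], forward continuity only sees [Q] and
    backward continuity only sees [P]. Elsewhere the radius is cut down to stay within one piece. *)
Lemma dpath_glue a b a' b' P Q : dpath a b P -> dpath a' b' Q -> P b = Q a' ->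
  dpath a (b + (b' - a')) (glue b a' P Q).
Proof.
move=> /dpathP[ab fP bP] /dpathP[ab' fQ bQ] PQ.
apply/dpathP; split; first by lra.
- move=> t e tab e0; have [tb|bt] := ltP t b.
    have tab' : a <= t <= b by lra.
    have [d d0 dP] := fP _ _ tab' e0.
    exists (Num.min d (b - t)); first by rewrite lt_min d0 subr_gt0.
    move=> s _; rewrite -ltrBlDl lt_min => /andP[ts /andP[sd sb]].
    by rewrite !glue_left ?dP//; lra.
  have tab' : a' <= t - b + a' <= b' by lra.
  have [d d0 dQ] := fQ _ _ tab' e0.
  exists d => // s sb std.
  by rewrite !glue_right//; [apply: dQ|]; lra.
- move=> t e tab e0; have [bt|tb] := ltP b t; last first.
    have tab' : a <= t <= b by lra.
    have [d d0 dP] := bP _ _ tab' e0.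
    exists d => // s as_ std.
    by rewrite !glue_left//; [apply: dP|]; lra.
  have tab' : a' <= t - b + a' <= b' by lra.
  have [d d0 dQ] := bQ _ _ tab' e0.
  exists (Num.min d (t - b)); first by rewrite lt_min d0 subr_gt0.
  move=> s _ /andP[sd st]; move: sd; rewrite ltrBlDl -ltrBlDr lt_min => /andP[sd sb].
  by rewrite !glue_right//; [apply: dQ| |]; lra.
Qed.

Lemma arclength_bound_glue a b a' b' P Q F G :
  a <= b -> P b = Q a' -> F b = G a' ->
  arclength_bound a b P F -> arclength_bound a' b' Q G ->
  arclength_bound a (b + (b' - a')) (glue b a' P Q) (glue b a' F G).
Proof.
move=> ab PQ FG PF QG s t as_ st tb.
have [tb'|bt] := leP t b.
  by rewrite !glue_left ?(le_trans st)//; exact: (PF _ _ as_ st).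
rewrite !(glue_right _ (ltW bt))//.
have [bs|sb] := leP b s.
  by rewrite !(glue_right _ bs)//; apply: (QG (_ - _ + _) (_ - _ + _)); lra.
rewrite !(glue_left _ _ _ (ltW sb)).
apply: le_trans (sdist_triangle _ _ (P b)) _.
rewrite -[X in X%:E](subrKA (F b)) [X in X%:E]addrC EFinD.
apply: leeD; first by apply: (PF s b) => //; exact: ltW.
by rewrite PQ FG; apply: (QG _ (_ - _ + _)); lra.
Qed.

Lemma broken_geodesic (z : nat -> X) (D : R) (n : nat) : geodesic_space X ->
  (forall k, (k <= n)%N -> (sdist (z k) (z k.+1) <= D%:E)%E) ->
  exists a b P F (m : nat -> R),
    [/\ dpath a b P, arclength_bound a b P F,
      {homo m : i j / (i <= j)%N >-> i <= j} /\ (m 0%N = a /\ m n.+1 = b),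
      forall k, (k <= n.+1)%N -> P (m k) = z k &
      forall k, (k <= n)%N -> F (m k.+1) - F (m k) <= D].
Proof.
move=> geoX zD.
(* Strengthened for the induction: [m] stays at [b] after index [n], so that all its values are at
   most [b]. *)
suff [a [b [P [F [m [dP PF [mm ma mb] Pm Fm]]]]]] : exists a b P F (m : nat -> R),
    [/\ dpath a b P, arclength_bound a b P F,
      [/\ {homo m : i j / (i <= j)%N >-> i <= j}, m 0%N = a &
        forall k, (n < k)%N -> m k = b],
      forall k, (k <= n.+1)%N -> P (m k) = z k &
      forall k, (k <= n)%N -> F (m k.+1) - F (m k) <= D].
  by exists a, b, P, F, m; split=> //; split=> //; split=> //; exact: mb.
have segment k : (k <= n)%N -> exists a b P F,
    [/\ dpath_from_to (z k) (z k.+1) a b P,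
    arclength_bound a b P F & F b - F a <= D].
  move=> /zD zkD; have [a [b [P gP]]] := geoX _ _ (le_lt_trans zkD (ltry D)).
  have [F [PF FD]] := geodesic_arclength gP zkD.
  by exists a, b, P, F; split=> //; case: gP.
elim: n zD segment => [|n IH] zD segment.
  have [a [b [P [F [[dP Pa Pb] PF FD]]]]] := segment 0%N (leqnn 0).
  have ab : a <= b by case: dP.
  exists a, b, P, F, (fun k => if k is _.+1 then b else a); split=> //.
  - by split=> //; [case=> [|?] [|?]|case].
  - by case=> [|[|]].
  - by case.
have [|k kn|a [b [P [F [m [dP PF [mm m0 mb] Pm Fm]]]]]] := IH.
  by move=> k kn; apply: zD; exact: leqW.
  by apply: segment; exact: leqW.
have [a' [b' [Q [G [[dQ Qa Qb] QG GD]]]]] := segment n.+1 (leqnn _).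
have [ab ab'] : a <= b /\ a' <= b' by case: dP; case: dQ.
have PQ : P b = Q a' by rewrite Qa -(mb n.+1)// Pm.
(* A constant shift keeps the increments of [G] and makes it continue [F] at the junction. *)
pose G' t := G t + (F b - G a').
have QG' : arclength_bound a' b' Q G'
  by move=> s t *; rewrite /G' opprD addrACA subrr addr0; exact: (QG s t).
have FG : F b = G' a' by rewrite /G' addrC subrK.
have mleb k : m k <= b.
  by rewrite -(mb (maxn k n.+1)) ?leq_max ?ltnSn ?orbT// mm// leq_maxl.
exists a, (b + (b' - a')), (glue b a' P Q), (glue b a' F G'),
  (fun k => if (k <= n.+1)%N then m k else b + (b' - a')).
have right : glue b a' P Q (b + (b' - a')) = z n.+2.
  by rewrite glue_right//; [rewrite -Qb; congr Q|]; lra.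
split.
- exact: dpath_glue.
- exact: arclength_bound_glue.
- split=> //; last by move=> k; rewrite ltnNge => /negbTE->.
  move=> i j ij; case: leqP => im; case: leqP => jm //; first exact: mm.
    by have := mleb i; lra.
  by have := leq_trans im ij; rewrite ltnNge jm.
- move=> k kn; case: leqP => kn'; first by rewrite glue_left ?mleb// Pm.
  by rewrite right; congr z; apply/eqP; rewrite eqn_leq kn'.
- move=> k kn; rewrite kn ltnS; case: (leqP k n) => kn'.
    by rewrite !glue_left ?mleb// Fm.
  have -> : k = n.+1 by apply/eqP; rewrite eqn_leq kn.
  rewrite mb// (glue_left _ _ _ (lexx b)) glue_right//; last by lra.
  have -> : b + (b' - a') - b + a' = b' by lra.
  by rewrite FG /G'; lra.
Qed.

End paths.

(** * Quasi-isometries *)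

Lemma locate_cell (R : realType) (m : nat -> R) (n : nat) (u : R) :
  m 0%N <= u <= m n.+1 -> exists2 k, (k <= n)%N & m k <= u <= m k.+1.
Proof.
elim: n => [|n IH] /andP[lu un]; first by exists 0%N; rewrite // lu.
have [un'|nu] := leP u (m n.+1).
  have [|k kn ku] := IH; first by rewrite lu.
  by exists k => //; exact: leqW.
by exists n.+1 => //; rewrite (ltW nu).
Qed.

Lemma ler_steps (R : realType) (w : nat -> R) (D : R) (n i l : nat) :
  (forall k, (k <= n)%N -> w k.+1 - w k <= D) -> (i + l <= n.+1)%N ->
  w (i + l)%N - w i <= l%:R * D.
Proof.
move=> wD; elim: l => [|l IH] il; first by rewrite addn0 subrr mul0r.
rewrite addnS -natr1 in il *.
by have := wD _ il; have := IH (ltnW il); lra.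
Qed.

Section quasi_isometries.
Context {R : realType} {X Y : semimetricType R}.
Implicit Types (f : X -> Y) (L e g c : R).

Definition quasi_isometric_embedding f L e : Prop :=
  [/\ 1 <= L, 0 <= e & forall x x' : X,
    (L^-1%:E * sdist x x' - e%:E <= sdist (f x) (f x'))%E /\
    (sdist (f x) (f x') <= L%:E * sdist x x' + e%:E)%E].

Lemma qi_upper f L e x x' (M : R) : quasi_isometric_embedding f L e ->
  (sdist x x' <= M%:E)%E -> (sdist (f x) (f x') <= (L * M + e)%:E)%E.
Proof.
move=> [L1 e0 fqi] xM; have [_ /le_trans] := fqi x x'; apply.
by rewrite EFinD EFinM leeD2r// lee_pmul2l//= lte_fin; lra.
Qed.

Lemma qi_lower f L e x x' (M : R) : quasi_isometric_embedding f L e ->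
  (sdist (f x) (f x') <= M%:E)%E -> (sdist x x' <= (L * (M + e))%:E)%E.
Proof.
move=> [L1 e0 fqi] fM; have L0 : 0 < L by lra.
 have [/le_trans/(_ fM)] := fqi x x'.
rewrite leeBlDr// -EFinD EFinM; set u := (_ + _)%:E => h _.
have <- : (L%:E * (L^-1%:E * sdist x x') = sdist x x')%E.
  by rewrite muleA -EFinM divff ?gt_eqF// mul1e.
by rewrite lee_pmul2l.
Qed.

(** [D] bounds the image under [f] of a step of distance at most 2, and [K] bounds the length of the
    piece of [P] over such a step. Each point is compared with the two subdivision points enclosing
    it, one before and one after. *)
Lemma quasi_geodesic_transfer f L e g c x y a b P
    (D := L * 2 + e) (K := g * 2 + c) :
  geodesic_space Y -> quasi_isometric_embedding f L e -> 1 <= g -> 0 <= c ->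
  quasi_geodesic g c x y a b P ->
  exists a' b' Q,
    [/\ quasi_geodesic (D * g * L) (D * (g * (L * (D + D + e)) + c + 1))
          (f x) (f y) a' b' Q,
      forall p, path_image a b P p -> exists q q',
        [/\ path_image a' b' Q (f q), (sdist q p <= K%:E)%E,
            path_image a' b' Q (f q') & (sdist p q' <= K%:E)%E] &
      forall w, path_image a' b' Q w -> exists q q',
        [/\ path_image a b P q, (sdist (f q) w <= D%:E)%E,
            path_image a b P q' & (sdist w (f q') <= D%:E)%E]].
Proof.
move=> geoY qif g1 c0 [[dP Pa Pb] qgP].
have [ab [L1 e0 _]] : a <= b /\ quasi_isometric_embedding f L e by case: dP.
have [m [n [mm m0 mn m2 m1]]] := coarse_subdivision dP.
have mab k : (k <= n.+1)%N -> a <= m k <= b by move=> kn; rewrite -m0 -mn !mm.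
have zD k : (k <= n)%N -> (sdist (f (P (m k))) (f (P (m k.+1))) <= D%:E)%E.
  by move=> kn; apply: (qi_upper qif); exact: m2.
have [a' [b' [Q [F [w [dQ QF [ww [w0 wn]] Qw Fw]]]]]] := broken_geodesic geoY zD.
have wab k : (k <= n.+1)%N -> a' <= w k <= b' by move=> kn; rewrite -w0 -wn !ww.
have D2 : 2 <= D by rewrite /D; lra.
have inQ k : (k <= n.+1)%N -> path_image a' b' Q (f (P (m k))).
  by move=> kn; exists (w k); [exact: wab|exact: Qw].
have inP k : (k <= n.+1)%N -> path_image a b P (P (m k)).
  by move=> kn; exists (m k) => //; exact: mab.
(* Since [F] is monotone, each part of a geodesic piece has increment at most that of the whole
   piece, hence at most [D]. *)
have nearQ u k : (k <= n)%N -> w k <= u <= w k.+1 ->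
    (sdist (f (P (m k))) (Q u) <= D%:E)%E /\
    (sdist (Q u) (f (P (m k.+1))) <= D%:E)%E.
  move=> kn /andP[ku uk]; have /andP[ak _] := wab _ (leqW kn).
  have /andP[_ kb] := wab k.+1 kn.
  rewrite -!Qw ?ltnS// 1?leqW//; have := Fw _ kn.
  have Fku := arclength_bound_homo QF ak ku (le_trans uk kb).
  have Fuk := arclength_bound_homo QF (le_trans ak ku) uk kb.
  move=> FD; split.
    by apply: le_trans (QF _ _ ak ku (le_trans uk kb)) _; rewrite lee_fin; lra.
  by apply: le_trans (QF _ _ (le_trans ak ku) uk kb) _; rewrite lee_fin; lra.
have g'0 : 0 < D * g * L by rewrite !mulr_gt0//; lra.
exists a', b', Q; split.
- split; first by split=> //; rewrite -?w0 -?wn Qw// ?m0 ?mn ?Pa ?Pb.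
  move=> s t as_ st tb.
  apply: (le_trans (path_length_le dQ as_ st tb _)).
    move=> u v su uv vt; apply: (QF u v) => //; first exact: le_trans su.
    exact: le_trans tb.
  have := sdist_ge0 (Q s) (Q t).
  case Qst: (sdist (Q s) (Q t)) => [d| |] // d0; last first.
    by rewrite gt0_muley// addye// leey.
  rewrite lee_fin in d0; rewrite -EFinM -EFinD lee_fin.
  have [|i ni /andP[is_ si]] := @locate_cell _ w n s.
    by rewrite w0 wn as_ (le_trans st).
  have [|j nj /andP[jt tj]] := @locate_cell _ w n t.
    by rewrite w0 wn tb (le_trans as_).
  have c'0 : 0 <= D * (g * (L * (D + D + e)) + c + 1).
    by rewrite mulr_ge0 ?addr_ge0 ?mulr_ge0//; lra.
  (* If [t] is located in an earlier piece than [s], both equal a common corner and the increment is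
     zero. *)
  have [ij|ji] := leqP i j; last first.
    have -> : t = s.
      apply/eqP; rewrite eq_le st andbT (le_trans tj)// (le_trans _ is_)//.
      exact: ww.
    by rewrite subrr addr_ge0// mulr_ge0// ltW.
  have [|si1 _] := nearQ s i ni; first by rewrite is_.
  have [|_ tj1] := nearQ t j nj; first by rewrite jt.
  have [l jE] : exists l, j = (i + l)%N by exists (j - i)%N; rewrite subnKC.
  subst j.
  have il : (i + l.+1 <= n.+1)%N by rewrite addnS.
  have Fst : F t - F s <= l.+1%:R * D.
    have := ler_steps Fw il; rewrite addnS.
    have /andP[ai _] := wab i (leqW ni); have /andP[_ jb] := wab (i + l).+1 nj.
    have := arclength_bound_homo QF ai is_ (le_trans st tb).
    by have := arclength_bound_homo QF (le_trans as_ st) tj jb; lra.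
  (* In [Y], go from the corner before [s] to [Q s], on to [Q t], and to the corner after [t], at
     cost [D + d + D]; then pull back along [f]. *)
  have dil : (sdist (P (m i)) (P (m (i + l.+1)%N)) <= (L * (d + D + D + e))%:E)%E.
    apply: (qi_lower qif); rewrite addnS.
    apply: le_trans (sdist_triangle _ _ (Q t)) _; rewrite EFinD leeD//.
    apply: le_trans (sdist_triangle _ _ (Q s)) _; rewrite addrC Qst EFinD leeD//.
  have lg : (l%:R%:E <= (g * (L * (d + D + D + e)) + c)%:E)%E.
    have /andP[ai _] := mab i (leqW ni); have /andP[_ ib] := mab _ il.
    have iil : m i <= m (i + l.+1)%N by apply: mm; exact: leq_addr.
    apply: (@le_trans _ _
      (g%:E * sdist (P (m i)) (P (m (i + l.+1)%N)) + c%:E)%E); last first.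
      by rewrite EFinD EFinM leeD2r// lee_pmul2l// lte_fin; lra.
    apply: le_trans (qgP _ _ ai iil ib).
    have im : {homo (fun k => m (i + k)%N) : j k / (j <= k)%N >-> j <= k}.
      by move=> j' k jk; apply: mm; rewrite leq_add2l.
    have m0i : m i <= m (i + 0)%N by rewrite addn0.
    have := chain_le_path_length (n := l.+1) dP ai iil ib im m0i (lexx _).
    apply: le_trans.
    (* The last of these [l.+1] steps may end the whole subdivision and be short, so it is dropped.
       The other [l] have distance at least 1; the dropped step accounts for the [+ 1] in the
       additive constant. *)
    rewrite chainS//; apply: le_trans (leeDl _ (sdist_ge0 _ _)).
    elim: l nj {jt tj tj1 ij il Fst dil ib iil} => [|l IH] nj.
      by rewrite chain_ge0.
    rewrite addnS in nj; rewrite chainS// -natr1 EFinD leeD ?IH 1?ltnW//.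
    by rewrite addnS; apply: m1.
  rewrite lee_fin in lg.
  rewrite -natr1 in Fst; apply: le_trans Fst _.
  have -> : D * g * L * d + D * (g * (L * (D + D + e)) + c + 1) =
     (g * (L * (d + D + D + e)) + c + 1) * D by ring.
  by rewrite ler_wpM2r ?lerD2r//; lra.
- move=> _ [s /= sab <-].
  have [|k kn /andP[ks sk]] := @locate_cell _ m n s; first by rewrite m0 mn.
  have /andP[ak _] := mab _ (leqW kn); have /andP[_ kb] := mab k.+1 kn.
  have := sdist2_le_path_length dP ak ks sk kb.
  move=> /le_trans/(_ (qgP _ _ ak (le_trans ks sk) kb)).
  have kK : (g%:E * sdist (P (m k)) (P (m k.+1)) + c%:E <= K%:E)%E.
    by rewrite EFinD EFinM leeD2r// lee_pmul2l ?m2//= lte_fin; lra.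
  move=> /le_trans/(_ kK) h.
  exists (P (m k)), (P (m k.+1)); split; [exact/inQ/leqW| |exact: inQ|].
    by apply: le_trans h; rewrite leeDl ?sdist_ge0.
  by apply: le_trans h; rewrite leeDr ?sdist_ge0.
- move=> _ [u /= uab <-].
  have [|k kn ku] := @locate_cell _ w n u; first by rewrite w0 wn.
  have [h1 h2] := nearQ _ _ kn ku.
  exists (P (m k)), (P (m k.+1)); split=> //; [exact/inP/leqW|exact: inP].
Qed.

End quasi_isometries.

Theorem proposition7p1 (R : realType) (X Y : semimetricType R)
  (geoX : geodesic_space X) (geoY : geodesic_space Y)
  (qiXY : quasi_isometric X Y) (stabY : geodesic_stability Y) :
  geodesic_stability X.
Proof.
move=> g c g1 c0; have [f [L [e [L1 e0 fqi _]]]] := qiXY.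
have qif : quasi_isometric_embedding f L e by split.
pose D := L * 2 + e; pose K := g * 2 + c.
pose g' := D * g * L; pose c' := D * (g * (L * (D + D + e)) + c + 1).
have D2 : 2 <= D by rewrite /D; lra.
have g'1 : 1 <= g' by rewrite !mulr_ege1//; lra.
have c'0 : 0 <= c' by rewrite mulr_ge0 ?addr_ge0 ?mulr_ge0//; lra.
have [k k0 stab] := stabY g' c' g'1 c'0.
(* In [Y], stability costs [k] and the way between [Q2] and a corner costs [D]; [qi_lower] pulls
   [k + D] back to [X], and [K] joins the subdivision point to [p]. *)
exists (L * (k + D + e) + K) => [|x y a b P a' b' Q qgP qgQ p Pp].
  by rewrite addr_ge0 ?mulr_ge0 ?addr_ge0 ?mulr_ge0//; lra.
have [a1 [b1 [P1 [qgP1 PP1 _]]]] := quasi_geodesic_transfer geoY qif g1 c0 qgP.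
have [a2 [b2 [Q2 [qgQ2 _ QQ2]]]] := quasi_geodesic_transfer geoY qif g1 c0 qgQ.
have [q [q' [P1q qp P1q' pq']]] := PP1 _ Pp.
have {}stab := stab _ _ _ _ _ _ _ _ qgP1 qgQ2.
(* The forward ball is used at [q], from which [p] is reached, and the backward ball at [q'], which
   is reached from [p]. *)
have [[v Q2v /= vq] _] := stab _ P1q; have [_ [v' Q2v' /= qv']] := stab _ P1q'.
have [r [_ [Qr rv _ _]]] := QQ2 _ Q2v; have [_ [r' [_ _ Qr' vr']]] := QQ2 _ Q2v'.
split.
  exists r => //=; apply: le_trans (sdist_triangle _ _ q) _.
  rewrite EFinD leeD//; apply: (qi_lower qif).
  apply: le_trans (sdist_triangle _ _ v) _.
  by rewrite addrC EFinD leeD.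
exists r' => //=; apply: le_trans (sdist_triangle _ _ q') _.
rewrite addrC EFinD leeD//; apply: (qi_lower qif).
apply: le_trans (sdist_triangle _ _ v') _.
by rewrite EFinD leeD.
Qed.
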